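(* Let $u,v,w$ be words of length $N$ and suppose that there exists at least one oriented TFPL of size $N$ with boundary $(u,v;w)$. Then: (1) $|u|_0=|v|_0=|w|_0$; (2) $u\le w$ and $v\le w$; (3) $\mathrm{d}(u)+\mathrm{d}(v)\le \mathrm{d}(w)$.
   Context: Let $N\ge 1$. $G^N$ is the induced subgraph of the square lattice $\mathbb{Z}^2$ formed by $N$ consecutive, horizontally centred rows having $3,5,\dots,2N+1$ vertices from top to bottom (e.g. row $k$ from the top consists of the points $(x,-k)$, $-k\le x\le k$). It is bipartite; vertices of the same colour as the leftmost vertex of each row are called odd, the others even. Let $B_1,\dots,B_N$ be the even vertices of the bottom row, $L_1,\dots,L_N$ the leftmost vertices of the rows, and $R_1,\dots,R_N$ the rightmost vertices of the rows, each family numbered from left to right (so $L_1$ is the leftmost vertex of the bottom row and $R_1$ the rightmost vertex of the top row). A TFPL of size $N$ is a subgraph $f$ of $G^N$ (a set of edges) such that each $L_i$ and each $R_i$ has degree $0$ or $1$, each $B_i$ has degree $1$, every other vertex has degree $2$, and no path of $f$ joins two vertices $L_i,L_j$ or two vertices $R_i,R_j$. An oriented TFPL is a TFPL together with an orientation of each of its edges such that every vertex of degree $2$ has one incoming and one outgoing edge, the edges at the $L_i$ are oriented away from $L_i$, and the edges at the $R_i$ are oriented into $R_i$. A word of length $N$ is $u=u_1\cdots u_N$ with $u_i\in\{0,1\}$; $|u|_0,|u|_1$ are the numbers of $0$s and $1$s. An oriented TFPL has boundary $(u,v;w)$ if for all $i$: $u_i=1$ iff $L_i$ has degree $1$; $v_i=0$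 iff $R_i$ has degree $1$; $w_i=1$ if $B_i$ has in-degree $1$ and $w_i=0$ if $B_i$ has out-degree $1$. $\mathrm{d}(u)$ is the number of inversions of $u$, i.e. pairs $i<j$ with $u_i=1$, $u_j=0$. The partial order on words of length $N$ is: $u\le v$ iff $|u_1\cdots u_i|_1\le |v_1\cdots v_i|_1$ for all $i=1,\dots,N$. *)

(* Defs.v *)
From mathcomp Require Import all_boot all_order all_algebra.
Set Implicit Arguments. Unset Strict Implicit. Unset Printing Implicit Defensive.
Import Order.TTheory GRing.Theory Num.Theory.

Definition vtx := (int * int)%type.

Local Open Scope ring_scope.

(* Vertex set of G^N: row k (1 <= k <= N) = {(x,-k) | -k <= x <= k}. *)
Definition inG (N : nat) (p : vtx) : bool :=
  [&& (1 <= - p.2), (- p.2 <= N%:Z) & (`|p.1| <= - p.2)].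

Definition nbrs (p : vtx) : seq vtx :=
  [:: (p.1 + 1, p.2); (p.1 - 1, p.2); (p.1, p.2 + 1); (p.1, p.2 - 1)].

Definition edgeG (N : nat) (p q : vtx) : bool :=
  [&& inG N p, inG N q & q \in nbrs p].

(* Paper's L_{i+1}, R_{i+1}, B_{i+1} for 0 <= i < N (0-based index i). *)
(* L_{i+1} = leftmost vertex of row N - i (L_1 leftmost of bottom row). *)
Definition Lv (N i : nat) : vtx := (- (N - i)%:Z, - (N - i)%:Z).
(* R_{i+1} = rightmost vertex of row i+1 (R_1 rightmost of top row). *)
Definition Rv (i : nat) : vtx := ((i.+1)%:Z, - (i.+1)%:Z).
(* B_{i+1} = (i+1)-th even vertex of the bottom row, from the left:
   x = -N + 2(i+1) - 1. *)
Definition Bv (N i : nat) : vtx := (- N%:Z + (2 * i + 1)%:Z, - N%:Z).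

(* A subgraph is given by a symmetric edge relation f; degree of p. *)
Definition deg (f : vtx -> vtx -> bool) (p : vtx) : nat :=
  count (fun q => f p q) (nbrs p).

(* Orientation o : o p q means the edge {p,q} is oriented p -> q. *)
Definition indeg (o : vtx -> vtx -> bool) (p : vtx) : nat :=
  count (fun q => o q p) (nbrs p).
Definition outdeg (o : vtx -> vtx -> bool) (p : vtx) : nat :=
  count (fun q => o p q) (nbrs p).

Definition joined (f : vtx -> vtx -> bool) (p q : vtx) : Prop :=
  exists s : seq vtx, path f p s /\ last p s = q.

Definition is_TFPL (N : nat) (f : vtx -> vtx -> bool) : Prop :=
  [/\ (forall p q, f p q = f q p),
      (forall p q, f p q -> edgeG N p q),
      (forall i, (i < N)%N -> (deg f (Lv N i) <= 1)%N /\ (deg f (Rv i) <= 1)%N),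
      (forall i, (i < N)%N -> deg f (Bv N i) = 1%N)
    & (forall p, inG N p ->
         (forall i, (i < N)%N -> [/\ p <> Lv N i, p <> Rv i & p <> Bv N i]) ->
         deg f p = 2%N)] /\
  (forall i j, (i < N)%N -> (j < N)%N -> i <> j ->
     ~ joined f (Lv N i) (Lv N j) /\ ~ joined f (Rv i) (Rv j)).

Definition is_orientation (N : nat) (f o : vtx -> vtx -> bool) : Prop :=
  [/\ (forall p q, o p q -> f p q),
      (forall p q, f p q -> o p q || o q p)
    & (forall p q, o p q -> ~~ o q p)] /\
  [/\
      (forall p, inG N p -> deg f p = 2%N -> indeg o p = 1%N /\ outdeg o p = 1%N),
      (forall i q, (i < N)%N -> f (Lv N i) q -> o (Lv N i) q)
    & (forall i q, (i < N)%N -> f (Rv i) q -> o q (Rv i))].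

(* Words of length N are seq bool (true = 1, false = 0); u_{i+1} = nth false u i. *)
Definition has_boundary (N : nat) (f o : vtx -> vtx -> bool) (u v w : seq bool) : Prop :=
  forall i, (i < N)%N ->
    [/\ nth false u i = (deg f (Lv N i) == 1%N),
        ~~ nth false v i = (deg f (Rv i) == 1%N),
        (indeg o (Bv N i) = 1%N -> nth false w i = true)
      & (outdeg o (Bv N i) = 1%N -> nth false w i = false)].

Definition oriented_TFPL_with_boundary (N : nat) (u v w : seq bool) : Prop :=
  exists f o : vtx -> vtx -> bool,
    [/\ is_TFPL N f, is_orientation N f o & has_boundary N f o u v w].

Local Close Scope ring_scope.

Definition nzeros (u : seq bool) : nat := count negb u.
Definition ninv (u : seq bool) : nat :=
  \sum_(i < size u) \sum_(j < size u)
     ((i < j) && nth false u i && ~~ nth false u j).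
Definition word_le (u v : seq bool) : Prop :=
  forall i, (1 <= i <= size u)%N -> count id (take i u) <= count id (take i v).

(* Main.v *)
(** Call a vertex even if x + y is odd.  The edges oriented from odd to even
  vertices and those oriented from even to odd vertices are two disjoint partial
  matchings m1 and m2; m1 leaves unmatched exactly the R_i, the L_i with
  u_i = 0 and the B_i with w_i = 0, and after the reflection x -> -x (which
  reverses words and exchanges 0 and 1) m2 has the same shape, so one argument
  serves for both.

  Sweeping over the antidiagonals x + y = c, the number of m1-edges that leave
  the even vertices of the i-th antidiagonal to the right or upwards is
  |w_1...w_i|_1 - |u_1...u_i|_1, and it vanishes for i = N.  This gives (1) and
  (2), and the total number A of these edges is d(w) - d(u).  In the same way,
  B = d(w) - d(v) for m2, and (3) becomes d(w) <= A + B.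

  Superposing m1 with the matching of each odd vertex with its right neighbour
  gives one path from the left side to each B_j with w_j = 0, and symmetrically
  m2 gives one path from the right side to each B_i with w_i = 1.  If i < j,
  these two paths must share an even vertex e.  There the m1-edge does not go
  left and the m2-edge does not go right (one of them is missing if e is some
  B_k, but then the other cannot go down); m1 and m2 being disjoint, they do not
  both go down, so one of them is counted in A or B.  Distinct inversions (i, j) have distinct e. *)

Require Import Defs.
From mathcomp Require Import all_boot all_order all_algebra zify.
Set Implicit Arguments. Unset Strict Implicit. Unset Printing Implicit Defensive.
Import Order.TTheory GRing.Theory Num.Theory.

Local Open Scope ring_scope.

(** * Half-matchings of the grid graph *)

Definition evenv (p : vtx) : bool := odd `|(p.1 + p.2)%R|%N.

Definition right (p : vtx) : vtx := (p.1 + 1, p.2).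
Definition left (p : vtx) : vtx := (p.1 - 1, p.2).
Definition up (p : vtx) : vtx := (p.1, p.2 + 1).
Definition down (p : vtx) : vtx := (p.1, p.2 - 1).

Definition mirror (p : vtx) : vtx := (- p.1, p.2).

(* [m p q] matches the even vertex [p] with the odd vertex [q]; [U i] and [W i] say
   whether [L_{i+1}] and [B_{i+1}] are matched. *)
Record half_matching (N : nat) (m : rel vtx) (U W : nat -> bool) : Prop :=
  HalfMatching {
    hm_graph : forall p q, m p q -> [/\ evenv p, inG N p, inG N q & q \in nbrs p];
    hm_even : forall p, inG N p -> evenv p -> p.2 != - N%:Z ->
      count (m p) (nbrs p) = 1%N;
    hm_bottom : forall i, (i < N)%N ->
      count (m (Bv N i)) (nbrs (Bv N i)) = W i;
    hm_odd : forall q, inG N q -> ~~ evenv q -> `|q.1| != - q.2 ->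
      count (m^~ q) (nbrs q) = 1%N;
    hm_left : forall i, (i < N)%N ->
      count (m^~ (Lv N i)) (nbrs (Lv N i)) = U i;
    hm_right : forall i, (i < N)%N ->
      count (m^~ (Rv i)) (nbrs (Rv i)) = 0%N }.

Lemma nbrsE (p : vtx) : nbrs p = [:: right p; left p; up p; down p].
Proof. by []. Qed.

Lemma leftK : cancel left right.
Proof. by case=> x y; rewrite /right /left /=; congr pair; lia. Qed.

Lemma rightK : cancel right left.
Proof. by case=> x y; rewrite /right /left /=; congr pair; lia. Qed.

Lemma upK : cancel up down.
Proof. by case=> x y; rewrite /up /down /=; congr pair; lia. Qed.

Lemma downK : cancel down up.
Proof. by case=> x y; rewrite /up /down /=; congr pair; lia. Qed.

Lemma mirrorK : involutive mirror.
Proof. by case=> x y; rewrite /mirror /= opprK. Qed.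

Lemma inG_mirror N p : inG N (mirror p) = inG N p.
Proof. by rewrite /inG /mirror /= normrN. Qed.

Lemma evenv_mirror p : evenv (mirror p) = evenv p.
Proof. rewrite /evenv /mirror /=; lia. Qed.

Lemma mem_nbrs_sym p q : (q \in nbrs p) = (p \in nbrs q).
Proof.
case: p q => [a b] [c d]; rewrite !inE /= !xpair_eqE; lia.
Qed.

Lemma evenv_nbrs p q : q \in nbrs p -> evenv q = ~~ evenv p.
Proof.
case: p q => [a b] [c d]; rewrite !inE /evenv /= !xpair_eqE; lia.
Qed.

Lemma count_le1_inj (T : eqType) (a : pred T) (s : seq T) x y :
  (count a s <= 1)%N -> x \in s -> y \in s -> a x -> a y -> x = y.
Proof.
elim: s => //= z s IH; rewrite !inE => c1.
have none t : t \in s -> a z -> a t -> False.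
  move=> ts az at_; have : (0 < count a s)%N by rewrite -has_count; apply/hasP; exists t.
  by rewrite az in c1; lia.
case/orP=> [/eqP->|xs]; case/orP=> [/eqP->|ys] // ax ay.
- by case: (none y).
- by case: (none x).
- by apply: IH => //; lia.
Qed.

Lemma count_nbrsE (m : rel vtx) p :
  count (m p) (nbrs p) = (m p (right p) + m p (left p) + m p (up p) + m p (down p))%N.
Proof. by rewrite nbrsE /= addn0 !addnA. Qed.

Lemma count_nbrs_revE (m : rel vtx) q :
  count (m^~ q) (nbrs q) =
  (m (right q) q + m (left q) q + m (up q) q + m (down q) q)%N.
Proof. by rewrite nbrsE /= addn0 !addnA. Qed.

Lemma inG_left_boundary N q : inG N q -> q.1 = q.2 ->
  exists2 i, (i < N)%N & q = Lv N i.
Proof.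
case: q => x y; rewrite /inG /Lv /= => h e; exists (N - `|y|)%N; first lia.
by congr pair; lia.
Qed.

Lemma inG_right_boundary N q : inG N q -> q.1 = - q.2 ->
  exists2 i, (i < N)%N & q = Rv i.
Proof.
case: q => x y; rewrite /inG /Rv /= => h e; exists (`|y|.-1)%N; first lia.
by congr pair; lia.
Qed.

Lemma even_bottom N p : inG N p -> evenv p -> p.2 = - N%:Z ->
  exists2 i, (i < N)%N & p = Bv N i.
Proof.
case: p => x y; rewrite /inG /evenv /Bv /= => h e yN.
exists (`|(x + N%:Z)%R|./2)%N; first lia.
by congr pair; lia.
Qed.

Lemma hm_uniq_even N m U W p q q' : half_matching N m U W ->
  m p q -> m p q' -> q = q'.
Proof.
move=> H pq pq'; have [pe pG qG qn] := hm_graph H pq.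
have [_ _ _ qn'] := hm_graph H pq'.
apply: (count_le1_inj (a := m p) _ qn qn') => //.
have [/(even_bottom pG pe)[i iN ->]|pN] := eqVneq p.2 (- N%:Z).
  by rewrite (hm_bottom H iN); case: (W i).
by rewrite (hm_even H).
Qed.

Lemma hm_not_right N m U W p q : half_matching N m U W ->
  m p q -> q.1 <> - q.2.
Proof.
move=> H pq e; have [pe pG qG qn] := hm_graph H pq.
have [i iN qR] := inG_right_boundary qG e.
have := hm_right H iN; rewrite -qR => /eqP; rewrite -leqn0 leqNgt -has_count.
by case/hasP; exists p; rewrite // mem_nbrs_sym.
Qed.

Lemma hm_uniq_odd N m U W p p' q : half_matching N m U W ->
  m p q -> m p' q -> p = p'.
Proof.
move=> H pq p'q; have [pe pG qG qn] := hm_graph H pq.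
have [pe' pG' _ qn'] := hm_graph H p'q.
rewrite mem_nbrs_sym in qn; rewrite mem_nbrs_sym in qn'.
apply: (count_le1_inj (a := m^~ q) _ qn qn') => //.
have qo : ~~ evenv q by rewrite -(evenv_nbrs qn).
have nR := hm_not_right H pq.
have [eL|nL] := eqVneq q.1 q.2.
  by have [i iN ->] := inG_left_boundary qG eL; rewrite (hm_left H iN); case: (U i).
by rewrite (hm_odd H) //; move: qG; rewrite /inG; lia.
Qed.

(** * Paths *)

(* The unit-width moves of the path: an odd vertex is followed by its right
   neighbour, an even vertex [p] by its partner [q] if [q] is to the right and by
   [right q] if [q] is above or below.  Path ends [B_j] are fixed points. *)
Definition step (m : rel vtx) (p : vtx) : vtx :=
  if evenv p then
    if m p (right p) then right p
    else if m p (up p) then right (up p)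
    else if m p (down p) then right (down p)
    else p
  else right p.

(* An even vertex matched with its left neighbour forms a trivial component of the
   superposition with the reference matching, so it lies on no path. *)
Definition on_path N (m : rel vtx) (p : vtx) : bool :=
  inG N p && (if evenv p then ~~ m p (left p) else m (left p) p).

(** Parity keeps even vertices off both sides. An odd vertex of a path is matched with its left
    neighbour, which is outside the graph for [L_i], while [R_i] is unmatched. *)
Lemma on_path_bound N m U W p : half_matching N m U W ->
  on_path N m p -> `|p.1| < - p.2.
Proof.
move=> H; rewrite /on_path; case: ifPn => pe /andP[pG].
  by move: pe pG; rewrite /evenv /inG; lia.
move=> lp; have nR := hm_not_right H lp.
have [_ lG _ _] := hm_graph H lp.
by move: lG pG nR; rewrite /inG /left /=; lia.
Qed.

(** The only partner of [q] is [p], so [right q] is not matched with [q]; it stays inside the graph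
    because no [R_i] is matched. *)
Lemma on_path_right N m U W p q : half_matching N m U W ->
  m p q -> p != right q -> on_path N m (right q).
Proof.
move=> H pq pr; have [pe pG qG qn] := hm_graph H pq.
have nR := hm_not_right H pq.
have qo : ~~ evenv q by rewrite (evenv_nbrs qn) pe.
have re : evenv (right q) by rewrite (@evenv_nbrs q) // nbrsE !inE eqxx.
rewrite /on_path re; apply/andP; split.
  by move: qG nR qo; rewrite /inG /evenv /=; lia.
by rewrite rightK; apply: contra pr => rq; apply/eqP; apply: hm_uniq_odd H pq rq.
Qed.

Lemma step_on_path N m U W p : half_matching N m U W -> on_path N m p ->
  step m p = p \/
  [/\ on_path N m (step m p), (step m p).1 = p.1 + 1,
      `|(step m p).2 - p.2| <= 1 & ~~ evenv p -> (step m p).2 = p.2].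
Proof.
move=> H pp; rewrite /step; case: ifPn => pe; last first.
  have lp : m (left p) p by move: pp; rewrite /on_path (negbTE pe) => /andP[].
  right; split=> //=; last by lia.
  apply: (on_path_right H lp); case: p {pp pe lp} => x y.
  by rewrite /left /right /= xpair_eqE; lia.
case: ifPn => pr.
  right; split=> //=; last by lia.
  have [_ _ rG rn] := hm_graph H pr.
  by rewrite /on_path rG (evenv_nbrs rn) pe /= rightK.
case: ifPn => pu.
  right; split=> //=; [|lia].
  apply: (on_path_right H pu); case: p {pp pe pr pu} => x y.
  by rewrite /left /right /= xpair_eqE; lia.
case: ifPn => pd; last by left.
right; split=> //=; [|lia].
apply: (on_path_right H pd); case: p {pp pe pr pu pd} => x y.
by rewrite /left /right /= xpair_eqE; lia.
Qed.

(** Paths can be walked backwards: from an even [q], the predecessor is read off from the partner of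
    [left q]. The walk stops once [left q] is some [L_i], which may lack a partner. *)
Lemma step_onto N m U W q : half_matching N m U W -> on_path N m q ->
  q.1 - 1 = q.2 \/
  exists p, [/\ on_path N m p, step m p = q, p.1 = q.1 - 1,
    `|p.2 - q.2| <= 1 & ~~ evenv q -> p.2 = q.2].
Proof.
move=> H qq; have qb := on_path_bound H qq.
have := qq; rewrite /on_path; case: ifPn => qe /andP[qG]; last first.
  move=> lq; right; exists (left q); split=> //=; last by lia.
    have [le lG _ _] := hm_graph H lq.
    rewrite /on_path le lG /=; apply/negP => ll.
    have := hm_uniq_even H lq ll; case: q {qq qb qe qG lq le lG ll} => x y.
    by rewrite /left => -[]; lia.
  have [le lG _ _] := hm_graph H lq.
  by rewrite /step le leftK lq.
move=> nlq; have [eL|nL] := eqVneq (q.1 - 1) q.2; [by left | right].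
have lG : inG N (left q) by move: qe qG qb; rewrite /inG /left /evenv /=; lia.
have lo : ~~ evenv (left q) by rewrite (@evenv_nbrs q) ?qe // nbrsE !inE eqxx orbT.
have lq := hm_odd H lG lo.
have {lq} : count (m^~ (left q)) (nbrs (left q)) = 1%N.
  by apply: lq; move: qe qG qb nL; rewrite /inG /left /evenv /=; lia.
move=> c1; have : has (m^~ (left q)) (nbrs (left q)) by rewrite has_count c1.
have offdiag (z y : vtx) : z.1 != y.1 \/ z.2 != y.2 -> z <> y.
  by move=> h zy; move: h; rewrite zy !eqxx => -[].
rewrite nbrsE /= orbF leftK (negbTE nlq) /= => /or3P[] mq;
  have [pe pG _ pn] := hm_graph H mq.
- exists (left q); split=> //=; [|by rewrite /step (negbTE lo) leftK|lia].
  by rewrite /on_path lG (negbTE lo).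
- exists (up (left q)); split=> //=; last 1 first.
  + lia.
  + rewrite /on_path pe pG /=; apply/negP => /(hm_uniq_even H mq).
    by apply: offdiag; rewrite /=; lia.
  rewrite /step pe upK mq leftK.
  case: ifP => [/(hm_uniq_even H mq)/offdiag[]|_]; first by rewrite /=; lia.
  by case: ifP => [/(hm_uniq_even H mq)/offdiag[]|_]; first by rewrite /=; lia.
- exists (down (left q)); split=> //=; last 1 first.
  + lia.
  + rewrite /on_path pe pG /=; apply/negP => /(hm_uniq_even H mq).
    by apply: offdiag; rewrite /=; lia.
  rewrite /step pe downK mq leftK.
  by case: ifP => [/(hm_uniq_even H mq)/offdiag[]|_]; first by rewrite /=; lia.
Qed.

Definition reaches (m : rel vtx) (p b : vtx) : Prop :=
  exists n, iter n (step m) p = b.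

Lemma reaches_step m p b : reaches m (step m p) b -> reaches m p b.
Proof. by case=> n <-; exists n.+1; rewrite iterSr. Qed.

(** Both ends equal the iterate of order [n + k] at [p]. *)
Lemma reaches_fixed m p b c : step m b = b -> step m c = c ->
  reaches m p b -> reaches m p c -> b = c.
Proof.
move=> sb sc [n nb] [k kc].
have fixK d l : step m d = d -> iter l (step m) d = d.
  by move=> sd; elim: l => //= l ->.
have : iter (n + k) (step m) p = c by rewrite iterD kc fixK.
by rewrite addnC iterD nb fixK.
Qed.

Lemma inG_bottom N i : (i < N)%N -> inG N (Bv N i) /\ evenv (Bv N i).
Proof. by rewrite /inG /evenv /Bv /=; lia. Qed.

Lemma bottom_unmatched N m U W i q : half_matching N m U W ->
  (i < N)%N -> W i = false -> m (Bv N i) q = false.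
Proof.
move=> H iN Wi; apply/negP => mq; have [_ _ _ qn] := hm_graph H mq.
have := hm_bottom H iN; rewrite Wi => /eqP; rewrite -leqn0 leqNgt -has_count.
by case/hasP; exists q.
Qed.

Lemma step_bottom N m U W i : half_matching N m U W ->
  (i < N)%N -> W i = false -> step m (Bv N i) = Bv N i.
Proof.
move=> H iN Wi; have [_ e] := inG_bottom iN.
by rewrite /step e !(bottom_unmatched _ H iN Wi).
Qed.

Lemma on_path_bottom N m U W i : half_matching N m U W ->
  (i < N)%N -> W i = false -> on_path N m (Bv N i).
Proof.
move=> H iN Wi; have [g e] := inG_bottom iN.
by rewrite /on_path g e (bottom_unmatched _ H iN Wi).
Qed.

(** Each backward step moves one column and at most one row, whence the height bound. The second
    alternative is a walk already stopped at the left side. *)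
Lemma path_at_column N m U W i : half_matching N m U W ->
  (i < N)%N -> W i = false -> forall n : nat,
  exists p, [/\ on_path N m p, reaches m p (Bv N i), p.2 <= n%:Z - N%:Z &
    p.1 = (Bv N i).1 - n%:Z \/ p.1 - 1 = p.2 /\ (Bv N i).1 - n%:Z < p.1 <= (Bv N i).1].
Proof.
move=> H iN Wi; elim=> [|n [p [pp pr ph pc]]].
  exists (Bv N i); split; [exact: on_path_bottom H iN Wi | by exists 0%N | |].
    by rewrite /=; lia.
  by left; lia.
case: pc => [pc|[pt pc]]; last by exists p; split=> //; [|right; split=> //]; lia.
have [pt|[q [qq sq qc qh _]]] := step_onto H pp.
  by exists p; split=> //; [|right; split=> //]; lia.
exists q; split=> //; [by apply: reaches_step; rewrite sq|lia|].
by left; lia.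
Qed.

(* The two height functions change by at most 1 per column, and an odd height
   difference means that exactly one of the paths is at an odd vertex, hence
   horizontal there; so the sign of the difference cannot change without
   vanishing.  If the paths coincide at an odd vertex, they also coincide at the
   even vertex to its left. *)
Lemma paths_cross N m1 U1 W1 m2 U2 W2 b k :
  half_matching N m1 U1 W1 -> half_matching N m2 U2 W2 ->
  forall (n : nat) p q,
  on_path N m1 p -> reaches m1 p b ->
  on_path N m2 (mirror q) -> iter n (step m2) (mirror q) = Bv N k ->
  (k < N)%N -> p.1 = q.1 -> p.2 <= q.2 ->
  exists e, [/\ evenv e, on_path N m1 e, on_path N m2 (mirror e),
     reaches m1 e b & reaches m2 (mirror e) (Bv N k)].
Proof.
move=> H1 H2; elim=> [|n IH] p q pp pr qq qr kN pq1 pq2.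
  (* Here [q] is in the bottom row, and [p], in the same column and not above [q], must coincide
     with it. *)
  have qB : q = mirror (Bv N k) by rewrite -[Bv N k]qr mirrorK.
  have pB : p = q.
    have := on_path_bound H1 pp; have := on_path_bound H2 qq.
    move: pp; rewrite /on_path /inG => /andP[]; move: pq1 pq2.
    rewrite qB; case: (p) => x y /= -> *; congr pair => /=; lia.
  exists q; split; [|by rewrite -pB|by []|by rewrite -pB|by exists 0%N].
  by rewrite qB evenv_mirror; case: (inG_bottom kN).
rewrite iterSr in qr.
have [pqe|pqn] := eqVneq p.2 q.2.
  have pq : p = q by case: (p) (q) pq1 pqe => [? ?] [? ?] /= -> ->.
  rewrite -pq in qq qr; case pe : (evenv p).
    by exists p; split=> //; apply: reaches_step; exists n.
  have me : evenv (mirror p) = false by rewrite evenv_mirror.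
  have lp : m1 (left p) p by move: pp; rewrite /on_path pe => /andP[].
  have lq : m2 (left (mirror p)) (mirror p).
    by move: qq; rewrite /on_path me => /andP[].
  have ml : mirror (left p) = right (mirror p).
    by rewrite /mirror /left /right /=; congr pair; lia.
  have [le lG _ _] := hm_graph H1 lp.
  exists (left p); split=> //.
  + rewrite /on_path lG le; apply/negP => /(hm_uniq_even H1 lp) /(congr1 fst) /=.
    lia.
  + rewrite ml; apply: (on_path_right H2 lq); apply/negP => /eqP /(congr1 fst) /=.
    lia.
  + by apply: reaches_step; rewrite /step le leftK lp.
  + by rewrite ml; exists n; rewrite -qr /step me.
(* Next to the left side, [p] is as high as [on_path_bound] allows in its column, so [q] cannot be
   strictly above it. *)
have [pt|[p' [pp' sp p'1 p'2 p'o]]] := step_onto H1 pp.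
  have := on_path_bound H2 qq; rewrite /mirror /=; lia.
have [sq|[qq' q'1 q'2 q'o]] := step_on_path H2 qq.
  by rewrite sq in qr; apply: IH pp pr qq qr kN pq1 pq2.
(* Both points move one column to the left: [p] backwards along the first path, [q] forwards along
   the reflected second one. *)
apply: (IH p' (mirror (step m2 (mirror q)))) => //.
- by apply: reaches_step; rewrite sp.
- by rewrite mirrorK.
- by rewrite mirrorK.
- by move: q'1; rewrite /mirror /=; lia.
- move: q'1 q'2 q'o; rewrite evenv_mirror /mirror /= => q'1 q'2 q'o.
  have [gap|gap] := leP (p.2 + 2) q.2; first by lia.
  case pe : (evenv p).
    have /q'o : ~~ evenv q by move: pe; rewrite /evenv; lia.
    lia.
  by have := p'o (negbT pe); lia.
Qed.

Lemma paths_meet N m1 U1 W1 m2 U2 W2 j k :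
  half_matching N m1 U1 W1 -> half_matching N m2 U2 W2 ->
  (j < N)%N -> (k < N)%N -> (N <= j + k)%N -> W1 j = false -> W2 k = false ->
  exists e, [/\ evenv e, on_path N m1 e, on_path N m2 (mirror e),
     reaches m1 e (Bv N j) & reaches m2 (mirror e) (Bv N k)].
Proof.
move=> H1 H2 jN kN jk Wj Wk.
(* By [N <= j + k], the mirror image of [B_{k+1}] lies to the left of [B_{j+1}], at exactly this
   distance. So [mirror q] is in the column of [B_{j+1}], unless the walk stops before reaching
   it. *)
have [q [qq [n qr] _ qc]] := path_at_column H2 kN Wk (2 * (j + k - N)).+2.
have qb := on_path_bound H2 qq.
have /andP[/and3P[_ qN _] _] := qq.
(* This aims at the column of [mirror q]. If that is the column of [B_{j+1}], then [p] is in the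
   bottom row; otherwise [mirror q] is as high as its column allows. Either way [p] is not above
   it. *)
have [p [pp pr ph pc]] := path_at_column H1 jN Wj `|((Bv N j).1 + q.1)%R|%N.
have pb := on_path_bound H1 pp.
have {}qc : q.1 = - (Bv N j).1 \/ q.1 - 1 = q.2 /\ - (Bv N j).1 < q.1.
  by move: qc; rewrite /Bv /=; lia.
move: ph pc qc; rewrite /Bv /= => ph pc qc.
apply: (paths_cross (q := mirror q) H1 H2 pp pr _ _ kN); rewrite ?mirrorK //;
  first exact: qr.
all: case: pc qc => [pc|[pt /andP[pc1 pc2]]] [qc|[qt qc]]; rewrite /mirror /=; lia.
Qed.

(** * Antidiagonals *)

(* Coordinates along antidiagonals: [ev N i t] and [od N i t], with [t <= i], are the
   vertices at height [t] above the bottom row on [x + y = 2(i - N) + 1] and on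
   [x + y = 2(i - N)]; so [ev N i 0] is [B_{i+1}] and [od N i i] is [L_{i+1}]. *)
Definition ev (N i t : nat) : vtx :=
  ((2 * i + 1)%N%:Z - t%:Z - N%:Z, t%:Z - N%:Z).
Definition od (N i t : nat) : vtx := ((2 * i)%N%:Z - t%:Z - N%:Z, t%:Z - N%:Z).

Definition forward (m : rel vtx) (p : vtx) : bool := m p (right p) || m p (up p).

Lemma forwardE N m U W p : half_matching N m U W ->
  forward m p = (m p (right p) + m p (up p))%N :> nat.
Proof.
move=> H; rewrite /forward; case mr : (m p (right p)) => //=.
case mu : (m p (up p)) => //.
have /(congr1 fst) /= := hm_uniq_even H mr mu; lia.
Qed.

Lemma hm_outside N m U W p q : half_matching N m U W ->
  ~~ inG N p || ~~ inG N q -> m p q = false.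
Proof. by move=> H; apply: contraTF => /(hm_graph H)[_ -> ->]. Qed.

Lemma antidiagonal_even N m U W i : half_matching N m U W -> (i < N)%N ->
  (\sum_(t < i.+1) (forward m (ev N i t) + m (ev N i t) (left (ev N i t)) +
     m (ev N i t) (down (ev N i t))) = i + W i)%N.
Proof.
move=> H iN.
have sumE t : (forward m (ev N i t) + m (ev N i t) (left (ev N i t)) +
    m (ev N i t) (down (ev N i t)))%N = count (m (ev N i t)) (nbrs (ev N i t)).
  by rewrite count_nbrsE (forwardE _ H); lia.
rewrite big_ord_recl sumE; have -> : ev N i (@ord0 i) = Bv N i.
  by rewrite /ev /Bv /=; congr pair; lia.
rewrite (hm_bottom H iN) addnC; congr addn.
transitivity (\sum_(t < i) 1)%N; last by rewrite sum_nat_const card_ord muln1.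
apply: eq_bigr => t _; rewrite sumE; apply: (hm_even H).
- by rewrite /inG /ev /= /bump /=; have := ltn_ord t; lia.
- by rewrite /evenv /ev /= /bump /=; have := ltn_ord t; lia.
- by rewrite /ev /= /bump /=; have := ltn_ord t; lia.
Qed.

(** Edges are counted at their odd ends: the even end is on [ev N i] if it is to the right or above,
    and otherwise on the previous antidiagonal, from which the edge goes forward. For [i = 0] the
    last sum is empty. *)
Lemma antidiagonal_odd N m U W i : half_matching N m U W -> (i < N)%N ->
  (\sum_(t < i.+1) (m (ev N i t) (left (ev N i t)) +
     m (ev N i t) (down (ev N i t))) +
   \sum_(t < i) forward m (ev N i.-1 t) = i + U i)%N.
Proof.
move=> H iN.
have <- : (\sum_(t < i.+1) count (m^~ (od N i t)) (nbrs (od N i t)) = i + U i)%N.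
  rewrite big_ord_recr; have -> : od N i (@ord_max i) = Lv N i.
    by rewrite /od /Lv /=; congr pair; lia.
  rewrite (hm_left H iN); congr addn.
  transitivity (\sum_(t < i) 1)%N; last by rewrite sum_nat_const card_ord muln1.
  apply: eq_bigr => t _; have := ltn_ord t => ti; apply: (hm_odd H).
  - by rewrite /inG /od /=; lia.
  - by rewrite /evenv /od /=; lia.
  - by rewrite /od /=; lia.
under [RHS]eq_bigr => t _ do rewrite count_nbrs_revE.
rewrite !big_split /=.
have -> : (\sum_(t < i.+1) m (right (od N i t)) (od N i t) =
    \sum_(t < i.+1) m (ev N i t) (left (ev N i t)))%N.
  apply: eq_bigr => t _; congr (nat_of_bool (m _ _));
    by rewrite /right /left /ev /od /=; congr pair; lia.
have -> : (\sum_(t < i.+1) m (up (od N i t)) (od N i t) =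
    \sum_(t < i.+1) m (ev N i t) (down (ev N i t)))%N.
  (* The neighbour above [od N i t] is [ev N i t.+1]; the two extreme terms belong to edges leaving
     the graph. *)
  rewrite big_ord_recr [RHS]big_ord_recl /=.
  rewrite (hm_outside H) /=; last by rewrite /inG /up /od /=; lia.
  rewrite [in RHS](hm_outside H) /=; last by rewrite /inG /down /ev /=; lia.
  rewrite addn0; apply: eq_bigr => t _; congr (nat_of_bool (m _ _));
    by rewrite /up /down /ev /od /= /bump /=; congr pair; lia.
have -> : (\sum_(t < i) forward m (ev N i.-1 t) =
    \sum_(t < i.+1) m (left (od N i t)) (od N i t) +
    \sum_(t < i.+1) m (down (od N i t)) (od N i t))%N.
  rewrite big_ord_recr [X in (_ + X)%N]big_ord_recl /=.
  rewrite (hm_outside H) /=; last by rewrite /inG /left /od /=; lia.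
  rewrite [m (down _) _](hm_outside H) /=; last by rewrite /inG /down /od /=; lia.
  rewrite addn0 -big_split; apply: eq_bigr => t _ /=; rewrite (forwardE _ H).
  have ti := ltn_ord t.
  by congr (nat_of_bool (m _ _) + nat_of_bool (m _ _))%N;
    rewrite /left /right /up /down /ev /od /= /bump /=; congr pair; lia.
by rewrite -!addnA; congr addn; rewrite addnCA.
Qed.

(** Between the two counts on an antidiagonal the left and down edges cancel, so the forward sum
    changes by [W i - U i] from one antidiagonal to the next. *)
Lemma forward_prefix N m U W i : half_matching N m U W -> (i < N)%N ->
  (\sum_(t < i.+1) forward m (ev N i t) + \sum_(b < i.+1) U b =
   \sum_(b < i.+1) W b)%N.
Proof.
move=> H; elim: i => [|i IH] iN;
  have := antidiagonal_odd H iN; have := antidiagonal_even H iN.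
  by rewrite !big_ord_recr !big_ord0 /=; lia.
have := IH (ltnW iN); rewrite [(\sum_(b < i.+2) U b)%N]big_ord_recr.
rewrite [(\sum_(b < i.+2) W b)%N]big_ord_recr /=.
under [(\sum_(t < i.+2) (_ + _ + _))%N]eq_bigr => t _ do rewrite -addnA.
rewrite [(\sum_(t < i.+2) (forward m _ + _))%N]big_split /=; lia.
Qed.

Lemma prefix_le N m U W i : half_matching N m U W -> (i <= N)%N ->
  (\sum_(b < i) U b <= \sum_(b < i) W b)%N.
Proof.
case: i => [|i] H iN; first by rewrite !big_ord0.
by have := forward_prefix H iN; lia.
Qed.

Lemma total_eq N m U W : half_matching N m U W ->
  (\sum_(b < N) U b = \sum_(b < N) W b)%N.
Proof.
case: N => [|N] H; first by rewrite !big_ord0.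
have <- := forward_prefix H (ltnSn N).
(* A forward edge from the last antidiagonal would end on the right side, where nothing is
   matched. *)
rewrite [X in (_ = X + _)%N]big1 // => t _; have tN := ltn_ord t.
rewrite (forwardE _ H).
have -> : m (ev N.+1 N t) (right (ev N.+1 N t)) = false.
  by apply/negP => /(hm_not_right H); rewrite /ev /=; lia.
have -> // : m (ev N.+1 N t) (up (ev N.+1 N t)) = false.
by apply/negP => /(hm_not_right H); rewrite /ev /=; lia.
Qed.

Definition inv (N : nat) (U : nat -> bool) : nat :=
  \sum_(i < N) \sum_(j < N) ((i < j)%N && U i && ~~ U j).

(** A final 0 forms an inversion with every earlier 1, a final 1 with none. *)
Lemma inv_recr n U : inv n.+1 U = (inv n U + ~~ U n * \sum_(i < n) U i)%N.
Proof.
rewrite /inv big_ord_recr /= [X in (_ + X)%N]big1 => [|j _]; last first.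
  by have := ltn_ord j; case: ltnP => //; lia.
rewrite addn0 big_distrr -big_split; apply: eq_bigr => i _ /=.
rewrite big_ord_recr /= ltn_ord; congr addn.
by case: (U i); case: (U n).
Qed.

(* Both terms on the right count pairs [i <= j] with [U i]: the inversions, and
   the pairs of ones. *)
Lemma sum_prefix_inv n (U : nat -> bool) :
  (\sum_(a < n) \sum_(b < a.+1) U b =
   inv n U + 'C((\sum_(b < n) U b).+1, 2))%N.
Proof.
elim: n => [|n IH]; first by rewrite /inv !big_ord0.
rewrite inv_recr big_ord_recr /= {}IH big_ord_recr /=.
by case: (U n); rewrite /= ?addn1 ?addn0 ?mul0n ?mul1n ?binS ?bin1 ?bin0; lia.
Qed.

(** The prefix identities are summed; the binomial terms cancel since [U] and [W] have equally many
    ones. *)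
Lemma forward_inv N m U W : half_matching N m U W ->
  (\sum_(i < N) \sum_(t < i.+1) forward m (ev N i t) + inv N U = inv N W)%N.
Proof.
move=> H; have := sum_prefix_inv N U; have := sum_prefix_inv N W.
rewrite (total_eq H).
have -> : (\sum_(a < N) \sum_(b < a.+1) W b =
    \sum_(i < N) \sum_(t < i.+1) forward m (ev N i t) +
    \sum_(a < N) \sum_(b < a.+1) U b)%N.
  by rewrite -big_split; apply: eq_bigr => i _ /=; rewrite (forward_prefix H).
lia.
Qed.

(** * Inversions and crossings *)

Lemma card_forward N m :
  #|[set x : 'I_N * 'I_N | (x.2 <= x.1)%N && forward m (ev N x.1 x.2)]| =
  (\sum_(i < N) \sum_(t < i.+1) forward m (ev N i t))%N.
Proof.
rewrite -sum1_card big_mkcond /=.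
transitivity (\sum_(i < N) \sum_(t < N)
    ((t <= i)%N && forward m (ev N i t)))%N.
  by rewrite pair_big; apply: eq_bigr => x _; rewrite inE; case: ifP.
apply: eq_bigr => i _.
rewrite (big_ord_widen _ (fun t => nat_of_bool (forward m (ev N i t))) (ltn_ord i)).
by rewrite [RHS]big_mkcond; apply: eq_bigr => t _ /=; rewrite ltnS; case: leqP.
Qed.

Lemma card_inversions N (U : nat -> bool) :
  #|[set x : 'I_N * 'I_N | [&& (x.1 < x.2)%N, U x.1 & ~~ U x.2]]| = inv N U.
Proof.
rewrite -sum1_card big_mkcond /inv pair_big; apply: eq_bigr => x _ /=.
by rewrite inE andbA; case: ifP.
Qed.

Lemma on_path_matched N m U W p : half_matching N m U W ->
  evenv p -> on_path N m p -> (0 < count (m p) (nbrs p))%N ->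
  forward m p || m p (down p).
Proof.
move=> H pe; rewrite /on_path pe => /andP[_ pl]; rewrite count_nbrsE.
by rewrite (negbTE pl) addn0 /forward; do 3!case: (m p _).
Qed.

Lemma mirror_down p : mirror (down p) = down (mirror p).
Proof. by []. Qed.

Lemma mirror_bottom N i : (i < N)%N -> mirror (Bv N i) = Bv N (N.-1 - i).
Proof. by move=> iN; rewrite /mirror /Bv /=; congr pair; lia. Qed.

(** The last two hypotheses on the matchings say that each [B_i] is covered by exactly one of them
    and that they share no edge. *)
Lemma crossing_forward N m1 U1 W1 m2 U2 W2 e :
  half_matching N m1 U1 W1 -> half_matching N m2 U2 W2 ->
  (forall i, (i < N)%N -> W2 (N.-1 - i)%N = ~~ W1 i) ->
  (forall p q, m1 p q -> ~~ m2 (mirror p) (mirror q)) ->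
  evenv e -> on_path N m1 e -> on_path N m2 (mirror e) ->
  forward m1 e || forward m2 (mirror e).
Proof.
move=> H1 H2 W12 m12 ee e1 e2; have /andP[eG _] := e1.
have fwd1 := on_path_matched H1 ee e1.
have fwd2 := on_path_matched H2 (etrans (evenv_mirror e) ee) e2.
have [/(even_bottom eG ee)[i iN eB]|eN] := eqVneq e.2 (- N%:Z).
  have outside x : ~~ inG N (down (x, - N%:Z)) by rewrite /inG /down /=; lia.
  have down1 : m1 e (down e) = false.
    by apply: (hm_outside H1); rewrite orbC eB outside.
  have down2 : m2 (mirror e) (down (mirror e)) = false.
    by apply: (hm_outside H2); rewrite orbC eB outside.
  rewrite down1 orbF in fwd1; rewrite down2 orbF in fwd2.
  case Wi : (W1 i).
    by rewrite fwd1 // eB (hm_bottom H1 iN) Wi.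
  rewrite fwd2 ?orbT // eB mirror_bottom // (hm_bottom H2); last by lia.
  by rewrite W12 // Wi.
have {}fwd1 := fwd1 (eq_leq (esym (hm_even H1 eG ee eN))).
have {}fwd2 : forward m2 (mirror e) || m2 (mirror e) (down (mirror e)).
  by apply: fwd2; rewrite (hm_even H2) ?inG_mirror ?evenv_mirror.
case: (forward m1 e) fwd1 => //= /m12; rewrite mirror_down => /negbTE d2.
by rewrite d2 orbF in fwd2.
Qed.

Lemma ev_surj N e : evenv e -> inG N e ->
  exists x : 'I_N * 'I_N, (x.2 <= x.1)%N /\ ev N x.1 x.2 = e.
Proof.
case: e => x y; rewrite /evenv /inG /= => e g.
have aN : (`|(x + y + 2%:Z * N%:Z)%R|./2 < N)%N by lia.
have tN : (`|(y + N%:Z)%R| < N)%N by lia.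
by exists (Ordinal aN, Ordinal tN); split=> /=; [lia | rewrite /ev; congr pair; lia].
Qed.

Lemma Bv_inj N : injective (Bv N).
Proof. by move=> i j [] /eqP; lia. Qed.

Lemma inv_le_forward N m1 U1 W1 m2 U2 W2 :
  half_matching N m1 U1 W1 -> half_matching N m2 U2 W2 ->
  (forall i, (i < N)%N -> W2 (N.-1 - i)%N = ~~ W1 i) ->
  (forall p q, m1 p q -> ~~ m2 (mirror p) (mirror q)) ->
  (inv N W1 <= \sum_(i < N) \sum_(t < i.+1) forward m1 (ev N i t) +
               \sum_(i < N) \sum_(t < i.+1) forward m2 (ev N i t))%N.
Proof.
move=> H1 H2 W12 m12; rewrite -!card_forward -card_inversions.
set X := [set x | _]; set Y1 := [set x | _]; set Y2 := [set x | _].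
pose T := ('I_N * 'I_N)%type.
pose Y := [set s : T + T | match s with inl x => x \in Y1 | inr x => x \in Y2 end].
have -> : (#|Y1| + #|Y2| = #|Y|)%N.
  rewrite -!sum1_card [RHS]big_mkcond big_sumType /= -!big_mkcond /=.
  by apply: f_equal2; apply: eq_bigl => x; rewrite [RHS]inE.
pose pt (s : T + T) :=
  match s with inl x => ev N x.1 x.2 | inr x => mirror (ev N x.1 x.2) end.
(* The index [N.-1 - x.1] is that of the mirror image of [B_{x.1+1}]. *)
have cross (x : T) : exists s : T + T, x \in X -> [/\ s \in Y,
    reaches m1 (pt s) (Bv N x.2) & reaches m2 (mirror (pt s)) (Bv N (N.-1 - x.1))].
  case xX : (x \in X); last by exists (inl x).
  move: xX; rewrite inE => /and3P[x12 Wx1 Wx2].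
  have x1N := ltn_ord x.1; have x2N := ltn_ord x.2.
  have kN : (N.-1 - x.1 < N)%N by lia.
  have jk : (N <= x.2 + (N.-1 - x.1))%N by lia.
  have Wk : W2 (N.-1 - x.1)%N = false by rewrite W12 // Wx1.
  have [e [ee e1 e2 r1 r2]] := paths_meet H1 H2 x2N kN jk (negbTE Wx2) Wk.
  have /andP[eG _] := e1; have meG : inG N (mirror e) by rewrite inG_mirror.
  have mee : evenv (mirror e) by rewrite evenv_mirror.
  have /orP[f1|f2] := crossing_forward H1 H2 W12 m12 ee e1 e2.
    have [y [y21 ye]] := ev_surj ee eG; exists (inl y) => _ /=.
    by rewrite !inE y21 ye.
  have [y [y21 ye]] := ev_surj mee meG; exists (inr y) => _ /=.
  by rewrite !inE y21 ye mirrorK.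
have [f fP] := fin_all_exists cross.
(* The shared vertex determines the ends of both paths, hence the inversion. *)
have f_inj : {in X &, injective f}.
  move=> x y xX yX fxy; have [_ x1 x2] := fP x xX; have [_ y1 y2] := fP y yX.
  rewrite fxy in x1 x2.
  move: xX yX; rewrite !inE => /and3P[_ Wx1 Wx2] /and3P[_ Wy1 Wy2].
  have last1 z : ~~ W1 z -> (z < N)%N -> step m1 (Bv N z) = Bv N z.
    by move=> Wz zN; apply: (step_bottom H1 zN); apply: negbTE.
  have last2 z : W1 z -> (z < N)%N ->
      step m2 (Bv N (N.-1 - z)) = Bv N (N.-1 - z).
    by move=> Wz zN; apply: (step_bottom H2); [lia | rewrite W12 // Wz].
  have := reaches_fixed (last1 _ Wx2 (ltn_ord _)) (last1 _ Wy2 (ltn_ord _)) x1 y1.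
  have := reaches_fixed (last2 _ Wx1 (ltn_ord _)) (last2 _ Wy1 (ltn_ord _)) x2 y2.
  case: x y {fxy x1 x2 y1 y2 Wx1 Wx2 Wy1 Wy2} => [a b] [c d] /= /Bv_inj ac /Bv_inj bd.
  have := ltn_ord a; have := ltn_ord c => cN aN.
  by congr pair; apply: val_inj => //=; lia.
rewrite -(card_in_imset f_inj); apply: subset_leq_card.
by apply/subsetP => _ /imsetP[x xX ->]; case: (fP x xX).
Qed.

(* Restricting the source to even vertices keeps every edge between an odd vertex
   and its neighbours, because all these neighbours are even. *)
Lemma half_matching_even_part N (g : rel vtx) (U W : nat -> bool) :
  (forall p q, g p q -> edgeG N p q) ->
  (forall p, inG N p -> evenv p -> p.2 != - N%:Z -> count (g p) (nbrs p) = 1%N) ->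
  (forall i, (i < N)%N -> count (g (Bv N i)) (nbrs (Bv N i)) = W i) ->
  (forall q, inG N q -> ~~ evenv q -> `|q.1| != - q.2 ->
     count (g^~ q) (nbrs q) = 1%N) ->
  (forall i, (i < N)%N -> count (g^~ (Lv N i)) (nbrs (Lv N i)) = U i) ->
  (forall i, (i < N)%N -> count (g^~ (Rv i)) (nbrs (Rv i)) = 0%N) ->
  half_matching N (fun p q => evenv p && g p q) U W.
Proof.
move=> gG ge gB go gL gR.
have oddE q : ~~ evenv q ->
    count (fun p => evenv p && g p q) (nbrs q) = count (g^~ q) (nbrs q).
  by move=> qo; apply: eq_in_count => p pn; rewrite (evenv_nbrs pn) qo.
split.
- by move=> p q /andP[pe /gG /and3P[]].
- by move=> p pG pe pN; rewrite pe /=; apply: ge.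
- by move=> i iN; have [_ ->] := inG_bottom iN; apply: gB.
- by move=> q qG qo qN; rewrite oddE //; apply: go.
- by move=> i iN; rewrite oddE ?gL // /evenv /Lv /=; lia.
- by move=> i iN; rewrite oddE ?gR // /evenv /Rv /=; lia.
Qed.

Lemma perm_nbrs_mirror p : perm_eq (nbrs (mirror p)) (map mirror (nbrs p)).
Proof.
rewrite !nbrsE /=.
have -> : right (mirror p) = mirror (left p).
  by rewrite /mirror /left /right /=; congr pair; lia.
have -> : left (mirror p) = mirror (right p).
  by rewrite /mirror /left /right /=; congr pair; lia.
by rewrite (perm_catCA [:: _] [:: _]).
Qed.

Lemma count_nbrs_mirror (a : pred vtx) p :
  count (fun q => a (mirror q)) (nbrs p) = count a (nbrs (mirror p)).
Proof. by rewrite (permP (perm_nbrs_mirror p)) count_map; apply: eq_count. Qed.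

(** * Oriented TFPLs *)

Lemma TFPL_degD N f o p : is_TFPL N f -> is_orientation N f o ->
  deg f p = (indeg o p + outdeg o p)%N.
Proof.
case=> -[fs _ _ _ _] _ [[of_ fo oo] _]; rewrite /deg /indeg /outdeg -count_predUI.
rewrite [X in (_ + X)%N](@eq_count _ _ pred0); last first.
  by move=> q /=; apply/negP => /andP[/oo/negP].
rewrite count_pred0 addn0; apply: eq_count => q /=.
apply/idP/orP => [/fo/orP[]|[/of_|/of_ //]]; [by right | by left |].
by rewrite fs.
Qed.

Lemma TFPL_degree N f o p : is_TFPL N f -> is_orientation N f o -> inG N p ->
  `|p.1| != - p.2 -> ~~ (evenv p && (p.2 == - N%:Z)) ->
  indeg o p = 1%N /\ outdeg o p = 1%N.
Proof.
move=> [[_ _ _ _ f2] _] [_ [o2 _ _]] pG pLR pB; apply: o2 => //; apply: f2 => // i iN.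
by split=> pE; move: pLR pB; rewrite pE /Lv /Rv /Bv /evenv /=; lia.
Qed.

Lemma TFPL_leftmost N f o i : is_TFPL N f -> is_orientation N f o -> (i < N)%N ->
  indeg o (Lv N i) = 0%N /\ outdeg o (Lv N i) = (deg f (Lv N i) == 1%N).
Proof.
move=> [[fs _ f1 _ _] _] [[of_ fo oo] [_ oL _]] iN.
have i0 : indeg o (Lv N i) = 0%N.
  apply/eqP; rewrite -leqn0 leqNgt -has_count; apply/hasP => -[q _ qL].
  by have := oo _ _ qL; rewrite oL // fs of_.
split=> //; rewrite /outdeg (eq_count (a2 := f (Lv N i))).
  by have [] := f1 i iN; rewrite /deg; case: count => [|[]].
by move=> q /=; apply/idP/idP => [/of_|/oL]; auto.
Qed.

Lemma TFPL_rightmost N f o i : is_TFPL N f -> is_orientation N f o -> (i < N)%N ->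
  outdeg o (Rv i) = 0%N /\ indeg o (Rv i) = (deg f (Rv i) == 1%N).
Proof.
move=> [[fs _ f1 _ _] _] [[of_ fo oo] [_ _ oR]] iN.
have i0 : outdeg o (Rv i) = 0%N.
  apply/eqP; rewrite -leqn0 leqNgt -has_count; apply/hasP => -[q _ qR].
  by have := oo _ _ qR; rewrite (oR _ _ iN) // of_.
split=> //; rewrite /indeg (eq_count (a2 := f (Rv i))).
  by have [_] := f1 i iN; rewrite /deg; case: count => [|[]].
by move=> q /=; apply/idP/idP => [/of_|/(oR _ _ iN)] //; rewrite fs.
Qed.

Lemma TFPL_bottom N f o i b : is_TFPL N f -> is_orientation N f o -> (i < N)%N ->
  (indeg o (Bv N i) = 1%N -> b = true) -> (outdeg o (Bv N i) = 1%N -> b = false) ->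
  indeg o (Bv N i) = b /\ outdeg o (Bv N i) = ~~ b.
Proof.
move=> fT oO iN bi bo; have [[_ _ _ fB _] _] := fT.
have := fB i iN; rewrite (TFPL_degD _ fT oO).
case: (indeg o _) bi => [|[]] bi; case: (outdeg o _) bo => [|[]] bo // _.
  by rewrite bo.
by rewrite bi.
Qed.

(** This is [m1]. Its degree is the in-degree at even vertices and the out-degree at odd ones, so
    every [R_i] is unmatched. *)
Lemma half_matching_in N f o u v w : is_TFPL N f -> is_orientation N f o ->
  has_boundary N f o u v w ->
  half_matching N (fun p q => evenv p && o q p) (nth false u) (nth false w).
Proof.
move=> fT oO bd; have [[_ fG _ _ _] _] := fT; have [[of_ _ _] _] := oO.
apply: half_matching_even_part.
- move=> p q /of_/fG; rewrite /edgeG mem_nbrs_sym => /and3P[-> -> ->] //.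
- move=> p pG pe pN; have [//||<- //] := TFPL_degree fT oO pG.
  + by move: pe; rewrite /evenv; lia.
  + by rewrite negb_and pN orbT.
- move=> i iN; have [_ _ bi bo] := bd i iN.
  by have [<-] := TFPL_bottom fT oO iN bi bo.
- move=> q qG qo qN; have [|_ <- //] := TFPL_degree fT oO qG qN.
  by rewrite (negbTE qo).
- by move=> i iN; have [-> _ _ _] := bd i iN; have [_ <-] := TFPL_leftmost fT oO iN.
- by move=> i iN; have [<- _] := TFPL_rightmost fT oO iN.
Qed.

(** This is [m2], reflected. Reflection swaps the sides and reverses the numbering; [R_i] is matched
    iff [v_i = 0] and [B_i] iff [w_i = 0], whence the complements. *)
Lemma half_matching_out N f o u v w : is_TFPL N f -> is_orientation N f o ->
  has_boundary N f o u v w ->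
  half_matching N (fun p q => evenv p && o (mirror p) (mirror q))
    (fun i => ~~ nth false v (N.-1 - i)) (fun i => ~~ nth false w (N.-1 - i)).
Proof.
move=> fT oO bd; have [[_ fG _ _ _] _] := fT; have [[of_ _ _] _] := oO.
have outdegE p : count (fun q => o (mirror p) (mirror q)) (nbrs p) = outdeg o (mirror p).
  by rewrite (count_nbrs_mirror (o (mirror p))).
have indegE q : count (fun p => o (mirror p) (mirror q)) (nbrs q) = indeg o (mirror q).
  by rewrite (count_nbrs_mirror (o^~ (mirror q))).
have revN i : (i < N)%N -> (N.-1 - i < N)%N by lia.
apply: half_matching_even_part.
- move=> p q /of_/fG; rewrite /edgeG !inG_mirror => /and3P[-> -> qn] /=.
  have := perm_mem (perm_nbrs_mirror p) (mirror q).
  by rewrite qn (mem_map (can_inj mirrorK)).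
- move=> p pG pe pN; rewrite outdegE.
  have [| | |_ <- //] := @TFPL_degree N f o (mirror p) fT oO.
  + by rewrite inG_mirror.
  + by move: pe; rewrite /evenv /mirror /=; lia.
  + by rewrite negb_and pN orbT.
- move=> i iN; rewrite outdegE mirror_bottom //; have [_ _ bi bo] := bd _ (revN i iN).
  by have [_ <-] := TFPL_bottom fT oO (revN i iN) bi bo.
- move=> q qG qo qN; rewrite indegE.
  have [| | |<- //] := @TFPL_degree N f o (mirror q) fT oO.
  + by rewrite inG_mirror.
  + by rewrite /mirror /= normrN.
  + by rewrite evenv_mirror (negbTE qo).
- move=> i iN; rewrite indegE; have [_ -> _ _] := bd _ (revN i iN).
  have -> : mirror (Lv N i) = Rv (N.-1 - i).
    by rewrite /mirror /Lv /Rv /=; congr pair; lia.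
  by have [_ <-] := TFPL_rightmost fT oO (revN i iN).
- move=> i iN; rewrite indegE.
  have -> : mirror (Rv i) = Lv N (N.-1 - i).
    by rewrite /mirror /Lv /Rv /=; congr pair; lia.
  by have [<- _] := TFPL_leftmost fT oO (revN i iN).
Qed.

(** * Words and their reversed complements *)

Lemma count_take (s : seq bool) i : (i <= size s)%N ->
  count id (take i s) = (\sum_(b < i) nth false s b)%N.
Proof.
elim: i => [|i IH] is_; first by rewrite take0 big_ord0.
rewrite (take_nth false is_) -cats1 count_cat /= addn0 IH ?big_ord_recr //.
exact: ltnW.
Qed.

Lemma nzeros_sum (s : seq bool) :
  (nzeros s + \sum_(b < size s) nth false s b = size s)%N.
Proof.
by rewrite -count_take // take_size /nzeros addnC -(count_predC id s).
Qed.

Lemma sum_rev_neg N (V : nat -> bool) i : (i <= N)%N ->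
  (\sum_(b < i) ~~ V (N.-1 - b) + \sum_(b < N) V b = i + \sum_(b < N - i) V b)%N.
Proof.
elim: i => [|i IH] iN; first by rewrite big_ord0 subn0.
have := IH (ltnW iN); have -> : (N - i = (N - i.+1).+1)%N by lia.
rewrite !big_ord_recr /=; have -> : (N.-1 - i = N - i.+1)%N by lia.
by case: (V _) => /=; lia.
Qed.

(** Reversal and complement each turn inversions into pairs 0 before 1, so together they preserve
    them. *)
Lemma inv_rev_neg N (V : nat -> bool) :
  inv N (fun i => ~~ V (N.-1 - i)%N) = inv N V.
Proof.
rewrite /inv exchange_big (reindex_inj rev_ord_inj) /=.
apply: eq_bigr => i _; rewrite (reindex_inj rev_ord_inj) /=.
apply: eq_bigr => j _; have := ltn_ord i; have := ltn_ord j => jN iN.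
have -> : (N.-1 - (N - j.+1) = j)%N by lia.
have -> : (N.-1 - (N - i.+1) = i)%N by lia.
have -> : (N - j.+1 < N - i.+1)%N = (i < j)%N by lia.
by case: (V i); case: (V j); rewrite /= ?andbT ?andbF.
Qed.

Local Close Scope ring_scope.

Theorem theorem3p1 (N : nat) (u v w : seq bool) :
  (1 <= N)%N -> size u = N -> size v = N -> size w = N ->
  oriented_TFPL_with_boundary N u v w ->
  [/\ nzeros u = nzeros v /\ nzeros v = nzeros w,
      word_le u w /\ word_le v w
    & (ninv u + ninv v <= ninv w)%N].
Proof.
move=> _ su sv sw [f [o [fT oO bd]]].
have H1 := half_matching_in fT oO bd; have H2 := half_matching_out fT oO bd.
have t1 := total_eq H1; have t2 := total_eq H2.
have revv := sum_rev_neg (nth false v); have revw := sum_rev_neg (nth false w).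
have totvw : \sum_(b < N) nth false v b = \sum_(b < N) nth false w b.
  have := revv N N (leqnn N); have := revw N N (leqnn N).
  by rewrite t2 subnn !big_ord0; lia.
split.
- have := nzeros_sum u; have := nzeros_sum v; have := nzeros_sum w.
  by rewrite su sv sw; lia.
- split=> i; rewrite ?su ?sv => /andP[_ iN]; rewrite !count_take ?su ?sv ?sw //.
    exact: prefix_le H1 iN.
  (* The prefix of length [N - i] of a reversed complement gives the last [N - i] letters of the
     word; as [v] and [w] have equally many ones, this compares their first [i] letters. *)
  have := prefix_le H2 (leq_subr i N).
  have := revv N _ (leq_subr i N); have := revw N _ (leq_subr i N).
  by rewrite subKn //; lia.
- have ninvE s : size s = N -> ninv s = inv N (nth false s) by move=> <-.
  have f1 := forward_inv H1; have := forward_inv H2; rewrite !inv_rev_neg => f2.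
  rewrite !ninvE // ; have := inv_le_forward H1 H2; rewrite -!ninvE // => le_w.
  suff : ninv w <= \sum_(i < N) \sum_(t < i.+1)
        forward (fun p q => evenv p && o q p) (ev N i t) +
      \sum_(i < N) \sum_(t < i.+1)
        forward (fun p q => evenv p && o (mirror p) (mirror q)) (ev N i t).
    by rewrite !ninvE //; lia.
  apply: le_w.
    by move=> i iN; congr (~~ nth _ _ _); lia.
  move=> p q /andP[pe oqp]; rewrite !mirrorK evenv_mirror pe /=.
  by have [[_ _ oo] _] := oO; apply: oo.
Qed.
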